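(* Let $G=(V,E)$ be a finite connected undirected graph with privacy labels, with largest public-cluster $C^*=(V^*,E^* )$ (having at least one edge), and run the designed random walk from a seed $v_{x_1}\in V^*$, recording the selection counts. Then for each sample $v_{x_k}$, the approximate public-degree $\hat d_{x_k}^*=d_{x_k}\frac{a_{x_k}}{b_{x_k}}$, computed from the first $r$ steps of the walk, converges (almost surely) to the public-degree $d_{x_k}^*$ as $r\to\infty$.
   Context: $G=(V,E)$, $V=\{v_1,\dots,v_n\}$, is a finite connected undirected (simple) graph; $d_i$ is the degree of $v_i$. Each node carries a fixed privacy label, public or private. The public-clusters are the connected components of the subgraph induced by the public nodes; $C^*=(V^*,E^* )$ is the (a fixed) public-cluster with the most nodes. For $v_i\in V^*$, the public-degree is $d_i^*=|\{v_j\in V^*:(v_i,v_j)\in E^*\}|$ (the number of public neighbors of $v_i$ in $G$). Designed random walk: the first sample is a seed $v_{x_1}\in V^*$. At step $k$, a neighbor $u$ of $v_{x_k}$ in $G$ is chosen uniformly at random; if $u$ is public, then $v_{x_{k+1}}=u$; otherwise a neighbor of $v_{x_k}$ is re-chosen uniformly at random, independently, until a public one is obtained. Counts: for a visited node $v_i$, over all visits of the walk to $v_i$ during steps $1,\dots,r$ (each step including its neighbor selections), $b_i$ is the total number of neighbor selections made at $v_i$ (successful or not), and $a_i$ is the total number of those selections that produced a public neighbor. The approximate public-degree of a visited node is $\hat d_i^*=d_i\,a_i/b_i$; it depends on $r$. *)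

(* Defs.v *)
From HB Require Import structures.
From mathcomp Require Import all_boot all_order all_algebra.
From mathcomp Require Import finmap.
From mathcomp Require Import all_classical all_reals all_analysis.
Set Implicit Arguments.
Unset Strict Implicit.
Unset Printing Implicit Defensive.
Import Order.TTheory GRing.Theory Num.Theory.
Import numFieldNormedType.Exports.
Local Open Scope classical_set_scope.
Local Open Scope ring_scope.

(* A graph is a symmetric irreflexive relation [e] on a finite type [V];
   [pub v] holds when the privacy label of [v] is "public". *)

Definition connected_graph (V : finType) (e : rel V) : Prop :=
  forall u v : V, connect e u v.

Definition degree (V : finType) (e : rel V) (v : V) : nat :=
  #|[set u : V | e v u]%SET|.

Definition public_subgraph (V : finType) (e : rel V) (pub : pred V) : rel V :=
  [rel u v | [&& pub u, pub v & e u v]].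

Definition public_cluster (V : finType) (e : rel V) (pub : pred V)
    (C : {set V}) : Prop :=
  exists2 u : V, pub u &
    C = [set v : V | connect (public_subgraph e pub) u v]%SET.

Definition largest_public_cluster (V : finType) (e : rel V) (pub : pred V)
    (C : {set V}) : Prop :=
  public_cluster e pub C /\
  forall D : {set V}, public_cluster e pub D -> (#|D| <= #|C|)%N.

Definition cluster_edge (V : finType) (e : rel V) (C : {set V}) : rel V :=
  [rel u v | [&& u \in C, v \in C & e u v]].

Definition public_degree (V : finType) (e : rel V) (C : {set V}) (v : V) : nat :=
  #|[set u in C | cluster_edge e C v u]%SET|.

(* The walk is driven by the sequence [s] of all its neighbor selections, in
   chronological order ([s 0] is the first one), successful or not. Each public
   selection ends the current step and moves the walk; a private one leaves the
   walk where it is. Selections are numbered from 0, steps and samples from 1. *)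

(* The node at which selection [t] is made; it depends only on the selections
   before [t]. *)
Fixpoint walk_pos (V : finType) (pub : pred V) (x1 : V) (s : nat -> V)
    (t : nat) : V :=
  if t is t'.+1 then
    if pub (s t') then s t' else walk_pos pub x1 s t'
  else x1.

(* The step to which selection [t] belongs. *)
Definition step_of (V : finType) (pub : pred V) (s : nat -> V) (t : nat) : nat :=
  ((\sum_(j < t) pub (s j)).+1)%N.

(* The k-th sample is the position during step [k], which is the same for all
   the selections of that step. The default 0 is only used when step [k] is not
   reached, an event of probability zero for the designed random walk. *)
Definition sample (V : finType) (pub : pred V) (x1 : V) (s : nat -> V)
    (k : nat) : V :=
  walk_pos pub x1 s (xget 0%N [set t | step_of pub s t = k]).

Definition selections (V : finType) (pub : pred V) (x1 : V) (s : nat -> V)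
    (r : nat) (v : V) : set nat :=
  [set t | (step_of pub s t <= r)%N /\ walk_pos pub x1 s t = v].

(* [fset_set] sends infinite sets to the empty one; [selections] is infinite
   only if one of the steps 1..r never ends, which has probability zero. *)
Definition b_count (V : finType) (pub : pred V) (x1 : V) (s : nat -> V)
    (r : nat) (v : V) : nat :=
  #|` fset_set (selections pub x1 s r v)|%fset.

Definition a_count (V : finType) (pub : pred V) (x1 : V) (s : nat -> V)
    (r : nat) (v : V) : nat :=
  #|` fset_set (selections pub x1 s r v `&` [set t | pub (s t)])|%fset.

Definition approx_public_degree (R : realType) (V : finType) (e : rel V)
    (pub : pred V) (x1 : V) (s : nat -> V) (r : nat) (v : V) : R :=
  (degree e v)%:R * ((a_count pub x1 s r v)%:R / (b_count pub x1 s r v)%:R).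

Definition uniform_neighbor (R : realType) (V : finType) (e : rel V)
    (v u : V) : R :=
  if e v u then (degree e v)%:R^-1 else 0.

(* Conditionally on all the previous selections, each selection is uniform
   among the neighbors of the current position. The law is stated in product
   form, so that histories of probability zero need no special treatment. *)
Definition designed_random_walk (R : realType) (V : finType) (e : rel V)
    (pub : pred V) (x1 : V) (d : measure_display) (T : measurableType d)
    (P : probability T R) (S : nat -> T -> V) : Prop :=
  (forall (t : nat) (v : V), measurable [set w | S t w = v]) /\
  (forall (t : nat) (s : nat -> V),
    P [set w | forall j : nat, (j < t.+1)%N -> S j w = s j] =
    (P [set w | forall j : nat, (j < t)%N -> S j w = s j] *
     (uniform_neighbor R e (walk_pos pub x1 s t) (s t))%:E)%E).

(* Main.v *)
Require Import Defs.
From HB Require Import structures.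
From mathcomp Require Import all_boot all_order all_algebra.
From mathcomp Require Import finmap ring lra.
From mathcomp Require Import all_classical all_reals all_analysis.
Set Implicit Arguments.
Unset Strict Implicit.
Unset Printing Implicit Defensive.
Import Order.TTheory GRing.Theory Num.Theory.
Import numFieldNormedType.Exports.
Local Open Scope classical_set_scope.
Local Open Scope ring_scope.

(* For a node x and a set A of nodes, the excess D of the number of selections
   made at x and falling in A over its conditional mean is a martingale, and
   exp (l D - 2 l^2 N) is a supermartingale, N being the number of selections
   made at x. By Ville's inequality it is almost surely bounded; letting l tend
   to 0 along both signs gives D = o(N) when N tends to infinity. With A = {y}
   this also shows that a node selected from infinitely often passes this
   property on to its public neighbors, so that every node of the cluster is
   visited infinitely often; the case where A is the set of public nodes then
   gives the limit. *)

(** * Events determined by finitely many selections *)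

(** Adaptedness to the filtration of the selections, phrased on plain sequences so that no
    sigma-algebra or conditional expectation is handled. *)
Definition determined_by_prefix (V B : Type) (n : nat) (F : (nat -> V) -> B) :
    Prop :=
  forall s s' : nat -> V, (forall j, (j < n)%N -> s j = s' j) -> F s = F s'.

Definition extend (V : Type) (s : nat -> V) (t : nat) (a : V) : nat -> V :=
  fun j => if j == t then a else s j.

Definition cylinder (V T : Type) (S : nat -> T -> V) (s : nat -> V) (t : nat) :
    set T :=
  [set w | forall j : nat, (j < t)%N -> S j w = s j].

(** Splitting on the value of the last relevant selection gives a finite union, [V] being finite;
    freezing that value leaves a property of a shorter prefix. With an empty prefix the property is
    constant. *)
Lemma measurable_determined_by_prefix (V : finType) (d : measure_display)
    (T : measurableType d) (S : nat -> T -> V)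
    (mS : forall t v, measurable [set w | S t w = v])
    (n : nat) (Q : (nat -> V) -> Prop) :
  determined_by_prefix n Q -> measurable [set w | Q (S ^~ w)].
Proof.
elim: n Q => [|n IHn] Q Qn.
  have [Qall|Qnone] := pselect (forall s, Q s).
    by rewrite (_ : mkset _ = setT) //; apply/seteqP; split => w //= _; exact: Qall.
  have [s nQs] : exists s, ~ Q s by exact/existsNP.
  rewrite (_ : mkset _ = set0) //; apply/seteqP; split => w //=.
  by rewrite (Qn _ s).
rewrite (_ : mkset _ = \bigcup_(a in [set: V])
    ([set w | S n w = a] `&` [set w | Q (extend (S ^~ w) n a)])).
  apply: fin_bigcup_measurable => [|a _]; first exact: finite_finset.
  apply: measurableI => //.
  apply: (IHn (fun s => Q (extend s n a))) => s s' ss'.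
  apply: Qn => j jn; rewrite /extend; have [//|nj] := eqVneq j n.
  by apply: ss'; rewrite ltn_neqAle nj -ltnS.
apply/seteqP; split => [w Qw|w [a _ [/= Sa]]].
  exists (S n w) => //; split => //=; rewrite (_ : extend _ _ _ = S ^~ w) //.
  by apply/funext => j; rewrite /extend; case: eqVneq => [->|].
rewrite (_ : extend _ _ _ = S ^~ w) //.
by apply/funext => j; rewrite /extend; case: eqVneq => [->|].
Qed.

Lemma measurable_cylinder (V : finType) (d : measure_display)
    (T : measurableType d) (S : nat -> T -> V)
    (mS : forall t v, measurable [set w | S t w = v]) (s : nat -> V) (t : nat) :
  measurable (cylinder S s t).
Proof.
apply: (@measurable_determined_by_prefix _ _ _ _ mS t
  (fun s' => forall j, (j < t)%N -> s' j = s j)) => s1 s2 s12.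
by apply/propext; split => h j jt; rewrite -h // s12.
Qed.

Lemma probability_bigcup_fin (V : finType) (R : realType) (d : measure_display)
    (T : measurableType d) (P : probability T R) (F : V -> set T) :
  (forall a, measurable (F a)) ->
  (P (\bigcup_(a in [set: V]) F a) <= \sum_a P (F a))%E.
Proof.
move=> mF; have -> : \bigcup_(a in [set: V]) F a = \big[setU/set0]_a F a.
  apply/seteqP; split => [w [a _ Faw]|].
    by rewrite (bigD1 a) //; left.
  by apply: (big_ind (fun X => X `<=` \bigcup_(a in [set: V]) F a)) => //;
    [move=> A B AF BF w [/AF|/BF]|move=> a _ w Fw; exists a].
suff [] : measurable (\big[setU/set0]_a F a) /\
  (P (\big[setU/set0]_a F a) <= \sum_a P (F a))%E by [].
apply: (big_ind2 (fun X x => measurable X /\ P X <= x)%E).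
- by rewrite measure0.
- move=> A x B y [mA Ax] [mB By]; split; first exact: measurableU.
  by apply: (le_trans (measureU2 _ mA mB)); exact: leeD.
- by move=> a _.
Qed.

Lemma walk_pos_prefix (V : finType) (pub : pred V) (x1 : V) (t : nat) :
  determined_by_prefix t (fun s => walk_pos pub x1 s t).
Proof.
elim: t => [//|t IHt] s s' ss' /=.
by rewrite ss' // (IHt s s') // => j jt; apply: ss'; exact: leqW.
Qed.

Lemma extend_lt (V : Type) (s : nat -> V) (t : nat) (a : V) (j : nat) :
  (j < t)%N -> extend s t a j = s j.
Proof. by rewrite /extend ltn_neqAle => /andP[/negbTE ->]. Qed.

Lemma extend_eq (V : Type) (s : nat -> V) (t : nat) (a : V) :
  extend s t a t = a.
Proof. by rewrite /extend eqxx. Qed.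

(** * Law of the cylinders and the maximal inequality *)

Lemma prob_cylinderS (R : realType) (V : finType) (e : rel V)
    (pub : pred V) (x1 : V) (d : measure_display) (T : measurableType d)
    (P : probability T R) (S : nat -> T -> V)
    (S_walk : designed_random_walk e pub x1 P S) (s : nat -> V) (t : nat) (a : V) :
  P (cylinder S (extend s t a) t.+1) =
  (P (cylinder S s t) *
    (uniform_neighbor R e (walk_pos pub x1 s t) a)%:E)%E.
Proof.
have [_ /(_ t (extend s t a))] := S_walk.
rewrite -/(cylinder S (extend s t a) t.+1) -/(cylinder S (extend s t a) t) => ->.
rewrite extend_eq; congr (P _ * (uniform_neighbor R e _ _)%:E)%E.
  by apply/seteqP; split => w ws j jt; rewrite ws // extend_lt.
by apply: walk_pos_prefix => j; exact: extend_lt.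
Qed.

(* Ville's maximal inequality. *)
Lemma ville_cylinder (R : realType) (V : finType) (e : rel V)
    (pub : pred V) (x1 : V) (d : measure_display) (T : measurableType d)
    (P : probability T R) (S : nat -> T -> V)
    (S_walk : designed_random_walk e pub x1 P S)
    (f : (nat -> V) -> nat -> R)
    (f_prefix : forall n, determined_by_prefix n (f ^~ n))
    (f_ge0 : forall s n, 0 <= f s n)
    (f_drift : forall s n,
      \sum_a uniform_neighbor R e (walk_pos pub x1 s n) a *
        f (extend s n a) n.+1 <= f s n)
    (K : R) (K_gt0 : 0 < K) (m t : nat) (s : nat -> V) :
  (P (cylinder S s t `&`
      [set w | exists2 n, (t <= n <= t + m)%N & (K <= f (S ^~ w) n)%R]) <=
   P (cylinder S s t) * (f s t / K)%:E)%E.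
Proof.
have [mS _] := S_walk.
have mE t' m' : measurable
    [set w | exists2 n, (t' <= n <= t' + m')%N & K <= f (S ^~ w) n].
  apply: (@measurable_determined_by_prefix _ _ _ _ mS (t' + m')
    (fun s => exists2 n, (t' <= n <= t' + m')%N & K <= f s n)) => s1 s2 s12.
  apply/propext; split => -[n /[dup] /andP[_ nm] tn] Kf; exists n => //.
    by rewrite -(f_prefix n s1) // => j jn; apply: s12; exact: leq_trans jn nm.
  by rewrite (f_prefix n s1 s2) // => j jn; apply: s12; exact: leq_trans jn nm.
have mC s' t' := measurable_cylinder mS s' t'.
(* Induction on the horizon [m], for all starting cylinders at once. If [f s t] already reaches [K],
   the factor [f s t / K] is at least 1 and the bound is trivial. *)
elim: m t s => [|m IHm] t s; have [Kf|fK] := leP K (f s t).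
1,3: apply: (@le_trans _ _ (P (cylinder S s t)));
  [by apply: le_measure; rewrite ?inE //; apply: measurableI|
   by rewrite -[leLHS]mule1; apply: lee_wpmul2l; rewrite // lee_fin ler_pdivlMr // mul1r].
  rewrite (_ : _ `&` _ = set0) ?measure0.
    by rewrite mule_ge0 // lee_fin divr_ge0 // ltW.
  apply/seteqP; split => w //= -[ws [n]]; rewrite addn0 -eqn_leq => /eqP <-.
  by rewrite (f_prefix t _ s) // leNgt fK.
(* Here [f] is below [K] at time [t], so a crossing occurs at [t.+1] or later; [F a] is that event
   when selection [t] is [a]. The induction hypothesis bounds each [F a], and the drift condition
   bounds the sum. *)
pose F a := cylinder S (extend s t a) t.+1 `&`
  [set w | exists2 n, (t.+1 <= n <= t.+1 + m)%N & K <= f (S ^~ w) n].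
have mF a : measurable (F a) by apply: measurableI.
apply: (@le_trans _ _ (P (\bigcup_(a in [set: V]) F a))).
  apply: le_measure; rewrite ?inE //; first exact: measurableI.
    by apply: fin_bigcup_measurable => //; exact: finite_finset.
  move=> w [ws [n tnm Kn]]; exists (S t w) => //; split.
    move=> j; rewrite ltnS leq_eqVlt => /predU1P[->|jt]; first by rewrite extend_eq.
    by rewrite extend_lt // ws.
  exists n => //; move: tnm; rewrite addnS -addSn => /andP[tn ->].
  rewrite andbT ltn_neqAle tn andbT; apply: contraTneq Kn => <-.
  by rewrite (f_prefix t _ s) // -ltNge.
apply: (le_trans (probability_bigcup_fin P mF)).
apply: (@le_trans _ _ (\sum_a P (cylinder S s t) *
   (uniform_neighbor R e (walk_pos pub x1 s t) a * (f (extend s t a) t.+1 / K))%:E)%E).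
  by apply: lee_sum => a _; rewrite EFinM muleA -(prob_cylinderS S_walk) IHm.
rewrite -(fineK (fin_num_measure P _ (mC s t))).
under eq_bigr do rewrite -EFinM.
rewrite sumEFin -EFinM lee_fin -mulr_sumr.
apply: ler_wpM2l; first by rewrite fine_ge0.
under eq_bigr do rewrite mulrA.
by rewrite -mulr_suml ler_pM2r // invr_gt0.
Qed.

(** Continuity from below lets the horizon of [ville_cylinder] tend to infinity, starting from the
    empty cylinder condition. The value of [f] at time 0 depends on no selection, so any [s] can
    name it. *)
Lemma ville (R : realType) (V : finType) (e : rel V)
    (pub : pred V) (x1 : V) (d : measure_display) (T : measurableType d)
    (P : probability T R) (S : nat -> T -> V)
    (S_walk : designed_random_walk e pub x1 P S)
    (f : (nat -> V) -> nat -> R)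
    (f_prefix : forall n, determined_by_prefix n (f ^~ n))
    (f_ge0 : forall s n, 0 <= f s n)
    (f_drift : forall s n,
      \sum_a uniform_neighbor R e (walk_pos pub x1 s n) a *
        f (extend s n a) n.+1 <= f s n)
    (K : R) (K_gt0 : 0 < K) (s : nat -> V) :
  measurable [set w | exists n, K <= f (S ^~ w) n] /\
  (P [set w | exists n, (K <= f (S ^~ w) n)%R] <= (f s 0%N / K)%:E)%E.
Proof.
have [mS _] := S_walk.
pose F m := [set w | exists2 n, (n <= m)%N & K <= f (S ^~ w) n].
have mF m : measurable (F m).
  apply: (@measurable_determined_by_prefix _ _ _ _ mS m
    (fun s => exists2 n, (n <= m)%N & K <= f s n)) => s1 s2 s12.
  apply/propext; split => -[n nm] Kf; exists n => //.
    by rewrite -(f_prefix n s1) // => j jn; apply: s12; exact: leq_trans jn nm.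
  by rewrite (f_prefix n s1 s2) // => j jn; apply: s12; exact: leq_trans jn nm.
have EF : [set w | exists n, K <= f (S ^~ w) n] = \bigcup_m F m.
  by apply/seteqP; split => [w [n Kn]|w [m _ [n _ Kn]]]; [exists n => //|]; exists n.
have mU : measurable (\bigcup_m F m) by exact: bigcup_measurable.
rewrite EF; split=> //.
have ndF : nondecreasing_seq F.
  move=> m m' mm'; apply/subsetPset => w [n nm Kn]; exists n => //.
  exact: leq_trans nm mm'.
have cF := nondecreasing_cvg_mu (mu := P) mF mU ndF.
rewrite -(cvg_lim _ cF) //; apply: lime_le.
  by apply/cvg_ex; eexists; exact: cF.
apply: nearW => m.
have := ville_cylinder S_walk f_prefix f_ge0 f_drift K_gt0 m 0 s.
have -> : cylinder S s 0 = setT by apply/seteqP; split.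
by rewrite setTI probability_setT mul1e add0n.
Qed.

(** An unbounded path reaches every level [k.+1], which has probability at most the initial value
    divided by [k.+1]. *)
Lemma ae_supermartingale_bounded (R : realType) (V : finType) (e : rel V)
    (pub : pred V) (x1 : V) (d : measure_display) (T : measurableType d)
    (P : probability T R) (S : nat -> T -> V)
    (S_walk : designed_random_walk e pub x1 P S)
    (f : (nat -> V) -> nat -> R)
    (f_prefix : forall n, determined_by_prefix n (f ^~ n))
    (f_ge0 : forall s n, 0 <= f s n)
    (f_drift : forall s n,
      \sum_a uniform_neighbor R e (walk_pos pub x1 s n) a *
        f (extend s n a) n.+1 <= f s n) :
  {ae P, forall w, exists K, forall n, f (S ^~ w) n <= K}.
Proof.
have vK := ville S_walk f_prefix f_ge0 f_drift.
pose E k := [set w | exists n, k.+1%:R <= f (S ^~ w) n].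
have mE k : measurable (E k) by have [] := vK k.+1%:R (ltr0Sn _ _) (fun=> x1).
exists (\bigcap_k E k); split; first exact: bigcap_measurable.
  apply/eqP; rewrite eq_le measure_ge0 andbT.
  apply/lee_addgt0Pr => eps eps0; rewrite add0e.
  pose f0 := f (fun=> x1) 0%N.
  have [k fk] : exists k : nat, f0 / eps < k.+1%:R.
    exists (Num.bound (f0 / eps)).
    apply: (@lt_trans _ _ (Num.bound (f0 / eps))%:R); last by rewrite ltr_nat.
    by apply: archi_boundP; rewrite divr_ge0 ?f_ge0 // ltW.
  apply: (@le_trans _ _ (P (E k))).
    apply: le_measure; rewrite ?inE //; first exact: bigcap_measurable.
    by move=> w; apply.
  have [_ ] := vK k.+1%:R (ltr0Sn _ _) (fun=> x1); move/le_trans; apply.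
  rewrite lee_fin ler_pdivrMr // mulrC -ler_pdivrMr //; exact: ltW.
move=> w /= /forallNP nb k _ /=.
by have /existsNP[n /negP] := nb k.+1%:R; rewrite -ltNge => /ltW ?; exists n.
Qed.

(** * Selection counts and the transition kernel *)

(** The relation [g] filters pairs (position, selected node), so that the same count serves for
    visits, hits of a set and illegal selections. *)
Definition selection_count (V : finType) (pub : pred V) (x1 : V) (g : rel V)
    (s : nat -> V) (n : nat) : nat :=
  (\sum_(j < n) g (walk_pos pub x1 s j) (s j))%N.

Definition from_into (V : finType) (x : V) (A : {set V}) : rel V :=
  [rel v u | (v == x) && (u \in A)].

Lemma selection_countS (V : finType) (pub : pred V) (x1 : V) (g : rel V)
    (s : nat -> V) (n : nat) :
  selection_count pub x1 g s n.+1 =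
  (selection_count pub x1 g s n + g (walk_pos pub x1 s n) (s n))%N.
Proof. exact: big_ord_recr. Qed.

Lemma selection_count_prefix (V : finType) (pub : pred V) (x1 : V) (g : rel V)
    (n : nat) :
  determined_by_prefix n (fun s => selection_count pub x1 g s n).
Proof.
move=> s s' ss'; apply: eq_bigr => j _; rewrite ss' //.
rewrite (@walk_pos_prefix _ pub x1 j s s') // => i ij.
by apply: ss'; exact: ltn_trans ij _.
Qed.

Lemma selection_count_extend (V : finType) (pub : pred V) (x1 : V) (g : rel V)
    (s : nat -> V) (n : nat) (a : V) :
  selection_count pub x1 g (extend s n a) n.+1 =
  (selection_count pub x1 g s n + g (walk_pos pub x1 s n) a)%N.
Proof.
rewrite selection_countS extend_eq.
have es j : (j < n)%N -> extend s n a j = s j by exact: extend_lt.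
by rewrite (selection_count_prefix _ _ _ es) (walk_pos_prefix _ _ es).
Qed.

Lemma uniform_neighbor_ge0 (R : realType) (V : finType) (e : rel V) (v u : V) :
  0 <= uniform_neighbor R e v u.
Proof. by rewrite /uniform_neighbor; case: ifP => // _; rewrite invr_ge0. Qed.

Lemma sum_uniform_neighbor (R : realType) (V : finType) (e : rel V) (v : V)
    (A : {set V}) :
  \sum_(a in A) uniform_neighbor R e v a =
  #|[set u in A | e v u]%SET|%:R / (degree e v)%:R.
Proof.
rewrite /uniform_neighbor -big_mkcondr /= sumr_const mulr_natl.
by congr (_ *+ _); apply: eq_card => u; rewrite !inE.
Qed.

(** The kernel has mass 0 at an isolated node, hence is only substochastic in general. *)
Lemma sum_uniform_neighborT (R : realType) (V : finType) (e : rel V) (v : V) :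
  \sum_a uniform_neighbor R e v a = (0 < degree e v)%N%:R.
Proof.
transitivity (\sum_(a in [set: V]%SET) uniform_neighbor R e v a).
  by apply: eq_bigl => a; rewrite !inE.
rewrite sum_uniform_neighbor (_ : #|_| = degree e v).
  by case: posnP => [->|d0]; [rewrite mulr0n mul0r|rewrite divff // pnatr_eq0 -lt0n].
by apply: eq_card => u; rewrite !inE.
Qed.

(** Selecting a non-neighbor has weight 0, so the number of such selections is a nonnegative
    supermartingale started at 0; Ville's inequality at level 1 gives probability 0 to its ever
    increasing. *)
Lemma ae_legal_selections (R : realType) (V : finType) (e : rel V)
    (pub : pred V) (x1 : V) (d : measure_display) (T : measurableType d)
    (P : probability T R) (S : nat -> T -> V)
    (S_walk : designed_random_walk e pub x1 P S) :
  {ae P, forall w, forall t, e (walk_pos pub x1 (S ^~ w) t) (S t w)}.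
Proof.
pose g : rel V := [rel v u | ~~ e v u].
pose f s n : R := (selection_count pub x1 g s n)%:R.
have f_prefix n : determined_by_prefix n (f ^~ n).
  by move=> s s' ss'; rewrite /f (selection_count_prefix _ _ _ ss').
have f_drift s n : \sum_a uniform_neighbor R e (walk_pos pub x1 s n) a *
    f (extend s n a) n.+1 <= f s n.
  rewrite (_ : \sum_a _ =
      \sum_a uniform_neighbor R e (walk_pos pub x1 s n) a * f s n).
    rewrite -mulr_suml sum_uniform_neighborT ler_piMl ?ler0n // lern1.
    exact: leq_b1.
  apply: eq_bigr => a _; rewrite /f selection_count_extend /uniform_neighbor /g /=.
  by case: (e _ a); rewrite /= ?addn0 // !mul0r.
have [mE PE] := ville S_walk f_prefix (fun _ _ => ler0n _ _) f_drift ltr01 (fun=> x1).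
exists [set w | exists n, 1 <= f (S ^~ w) n]; split => //.
  apply/eqP; rewrite eq_le measure_ge0 andbT (le_trans PE) //.
  by rewrite divr1 /f /selection_count big_ord0.
move=> w /= /existsNP[t /negP nt]; exists t.+1.
by rewrite /f selection_countS /g /= nt addn1 ler1n.
Qed.

(** * The exponential supermartingale *)

(** From [1 - y <= expR (- y)], the exponential is at most [(1 - y)^-1]; the quadratic times [1 - y]
    is [1 + y ^+ 2 * (1 - 2 * y)], which is at least 1 as soon as [y <= 2^-1]. *)
Lemma expR_le_quadratic (R : realType) (y : R) :
  `|y| <= 2^-1 -> expR y <= 1 + y + 2 * y ^+ 2.
Proof.
rewrite ler_norml => /andP[ly yu].
have h : 1 - y <= expR (- y) by have := expR_ge1Dx (- y).
have p : 0 < 1 - y by lra.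
apply: (@le_trans _ _ (1 - y)^-1).
  by rewrite -[expR y]invrK -expRN lef_pV2 // posrE expR_gt0.
rewrite -[X in X <= _]mul1r ler_pdivrMr //.
have -> : (1 + y + 2 * y ^+ 2) * (1 - y) = 1 + y ^+ 2 * (1 - 2 * y) by ring.
by rewrite lerDl mulr_ge0 ?sqr_ge0 //; lra.
Qed.

Definition transition_prob (R : realType) (V : finType) (e : rel V) (x : V)
    (A : {set V}) : R :=
  \sum_(a in A) uniform_neighbor R e x a.

Definition deviation (R : realType) (V : finType) (e : rel V) (pub : pred V)
    (x1 x : V) (A : {set V}) (s : nat -> V) (n : nat) : R :=
  (selection_count pub x1 (from_into x A) s n)%:R -
  transition_prob R e x A * (selection_count pub x1 (from_into x [set: V]%SET) s n)%:R.

Lemma transition_prob_itv (R : realType) (V : finType) (e : rel V) (x : V)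
    (A : {set V}) : 0 <= transition_prob R e x A <= (0 < degree e x)%N%:R.
Proof.
apply/andP; split.
  by apply: sumr_ge0 => a _; exact: uniform_neighbor_ge0.
rewrite -sum_uniform_neighborT [leRHS](bigID (mem A)) /= lerDl.
by apply: sumr_ge0 => a _; exact: uniform_neighbor_ge0.
Qed.

(** Away from [x] the exponent does not move. At [x] it changes by [y a - 2 * l ^+ 2], where [y] is
    centered and bounded by [2^-1]; so [expR (y a)] has mean at most [1 + 2 * l ^+ 2], hence at most
    [expR (2 * l ^+ 2)]. *)
Lemma exp_deviation_drift (R : realType) (V : finType) (e : rel V)
    (pub : pred V) (x1 x : V) (A : {set V}) (l : R) (l_le : `|l| <= 2^-1)
    (f := fun s n => expR (l * deviation R e pub x1 x A s n -
      2 * l ^+ 2 * (selection_count pub x1 (from_into x [set: V]%SET) s n)%:R))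
    (s : nat -> V) (n : nat) :
  \sum_a uniform_neighbor R e (walk_pos pub x1 s n) a * f (extend s n a) n.+1 <=
  f s n.
Proof.
have [xn|nx] := eqVneq (walk_pos pub x1 s n) x; last first.
  rewrite (_ : \sum_a _ =
      \sum_a uniform_neighbor R e (walk_pos pub x1 s n) a * f s n).
    by rewrite -mulr_suml sum_uniform_neighborT ler_piMl ?expR_ge0 // lern1 leq_b1.
  apply: eq_bigr => a _; rewrite /f /deviation !selection_count_extend /from_into /=.
  by rewrite (negbTE nx) !addn0.
rewrite xn; set q := transition_prob R e x A.
have /andP[q0 qb] := transition_prob_itv R e x A; rewrite -/q in q0 qb.
pose y a := l * ((a \in A)%:R - q).
have fE a : f (extend s n a) n.+1 = f s n * expR (- (2 * l ^+ 2)) * expR (y a).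
  rewrite /f -!expRD; congr expR; rewrite /deviation !selection_count_extend /from_into /=.
  by rewrite xn eqxx /= !inE /= !natrD -/q /y; ring.
have sum_u_le : \sum_a uniform_neighbor R e x a * expR (y a) <= 1 + 2 * l ^+ 2.
  have yl a : `|y a| <= `|l|.
    rewrite normrM ler_piMr // ler_norml.
    have q1 : q <= 1 by apply: le_trans qb _; rewrite lern1 leq_b1.
    by case: (a \in A) => /=; lra.
  apply: (@le_trans _ _ (\sum_a (uniform_neighbor R e x a * (1 + 2 * l ^+ 2 - l * q) +
      l * (uniform_neighbor R e x a * (a \in A)%:R)))).
    apply: ler_sum => a _.
    rewrite (_ : _ + _ = uniform_neighbor R e x a * (1 + y a + 2 * l ^+ 2));
      last by rewrite /y; ring.
    apply: ler_wpM2l; first exact: uniform_neighbor_ge0.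
    apply: le_trans (expR_le_quadratic (le_trans (yl a) l_le)) _.
    rewrite lerD2l ler_pM2l // -[y a ^+ 2]real_normK ?num_real //.
    by rewrite -[l ^+ 2]real_normK ?num_real // lerXn2r ?nnegrE.
  rewrite big_split /= -mulr_suml -mulr_sumr sum_uniform_neighborT.
  rewrite (_ : \sum_a _ = q); last first.
    rewrite /q /transition_prob [RHS]big_mkcond /=; apply: eq_bigr => a _.
    by case: (a \in A); rewrite ?mulr1 ?mulr0.
  have l2 : 0 <= l ^+ 2 by exact: sqr_ge0.
  (* With mass 1 the two terms [l * q] cancel; at an isolated node both the mass and [q] vanish. *)
  case: (0 < degree e x)%N qb => /= qb; first by lra.
  by rewrite (_ : q = 0); [lra|apply/le_anti; rewrite qb].
under eq_bigr do rewrite fE mulrCA.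
rewrite -mulr_sumr -mulrA; apply: ler_piMr; first exact: expR_ge0.
rewrite expRN mulrC ler_pdivrMr ?expR_gt0 // mul1r.
exact: le_trans sum_u_le (expR_ge1Dx _).
Qed.

(** * Almost sure bounds on the deviations *)

Lemma ae_forall_countable (R : realType) (d : measure_display)
    (T : measurableType d) (P : probability T R) (I : countType)
    (Q : I -> T -> Prop) :
  (forall i, {ae P, forall w, Q i w}) -> {ae P, forall w, forall i, Q i w}.
Proof.
move=> aeQ.
have : {ae P, forall w, forall n, oapp (Q ^~ w) True (@choice.unpickle I n)}.
  by apply: ae_foralln => n; case: choice.unpickle => [i|]; [exact: aeQ|exact: aeW].
by apply: filterS => w Qw i; have := Qw (choice.pickle i); rewrite choice.pickleK.
Qed.

(** The supermartingale is used with parameters [l] and [- l] to bound the deviation on both sides;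
    dividing by [l] turns the slope [2 * l ^+ 2] into [2 * l]. *)
Lemma ae_deviation_affine (R : realType) (V : finType) (e : rel V)
    (pub : pred V) (x1 : V) (d : measure_display) (T : measurableType d)
    (P : probability T R) (S : nat -> T -> V)
    (S_walk : designed_random_walk e pub x1 P S) (x : V) (A : {set V}) (l : R)
    (l_gt0 : 0 < l) (l_le : l <= 2^-1) :
  {ae P, forall w, exists K : R, forall n,
    `|deviation R e pub x1 x A (S ^~ w) n| <=
    2 * l * (selection_count pub x1 (from_into x [set: V]%SET) (S ^~ w) n)%:R + K}.
Proof.
have aeK (m : R) : `|m| <= 2^-1 -> {ae P, forall w, exists K : R, forall n,
    m * deviation R e pub x1 x A (S ^~ w) n <=
    2 * m ^+ 2 * (selection_count pub x1 (from_into x [set: V]%SET) (S ^~ w) n)%:R + K}.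
  move=> m_le.
  pose f s n := expR (m * deviation R e pub x1 x A s n -
      2 * m ^+ 2 * (selection_count pub x1 (from_into x [set: V]%SET) s n)%:R).
  have f_prefix n : determined_by_prefix n (f ^~ n).
    move=> s s' ss'.
    by rewrite /f /deviation !(selection_count_prefix _ _ _ ss').
  have := ae_supermartingale_bounded S_walk f_prefix (fun _ _ => expR_ge0 _)
    (exp_deviation_drift e pub x1 x A m_le).
  apply: filterS => w [K fK]; exists K => n.
  (* The inequality [1 + z <= expR z] bounds the exponent without a logarithm. *)
  by have := le_trans (expR_ge1Dx _) (fK n); lra.
have l_abs : `|l| <= 2^-1 by rewrite gtr0_norm.
have Nl_abs : `|- l| <= 2^-1 by rewrite normrN.
apply: filterS2 (aeK _ l_abs) (aeK _ Nl_abs) => w [K1 h1] [K2 h2].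
exists ((`|K1| + `|K2|) / l) => n.
rewrite -(ler_pM2l l_gt0) mulrDr [l * (_ / l)]mulrC divfK ?gt_eqF //.
rewrite -[X in X * `|_|](gtr0_norm l_gt0) -normrM ler_norml.
have := h1 n; have := h2 n; have := ler_norm K1; have := ler_norm K2.
rewrite sqrrN mulNr; move: (normr_ge0 K1) (normr_ge0 K2) => ? ? ? ? ? ?.
by apply/andP; split; lra.
Qed.

(** The parameters [l = i.2.+2%:R^-1] are countably many, lie below [2^-1] and tend to 0, so one
    null set serves every [eps]. *)
Lemma ae_frequencies (R : realType) (V : finType) (e : rel V)
    (pub : pred V) (x1 : V) (d : measure_display) (T : measurableType d)
    (P : probability T R) (S : nat -> T -> V)
    (S_walk : designed_random_walk e pub x1 P S) :
  {ae P, forall w, forall (x : V) (A : {set V}) (eps : R), 0 < eps ->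
    exists K : R, forall n,
    `|deviation R e pub x1 x A (S ^~ w) n| <=
    eps * (selection_count pub x1 (from_into x [set: V]%SET) (S ^~ w) n)%:R + K}.
Proof.
have : {ae P, forall w, forall i : V * {set V} * nat, exists K : R, forall n,
    `|deviation R e pub x1 i.1.1 i.1.2 (S ^~ w) n| <=
    2 * i.2.+2%:R^-1 *
      (selection_count pub x1 (from_into i.1.1 [set: V]%SET) (S ^~ w) n)%:R + K}.
  apply: ae_forall_countable => -[[x A] j] /=.
  apply: (ae_deviation_affine S_walk); rewrite ?invr_gt0 //.
  by rewrite lef_pV2 ?posrE // ler_nat.
apply: filterS => w Hw x A eps eps0.
have [K HK] := Hw (x, A, Num.bound (2 / eps)); exists K => n.
apply: le_trans (HK n) _; rewrite /= lerD2r ler_wpM2r //.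
rewrite ler_pdivrMr // mulrC -ler_pdivrMr // ltW //.
apply: (@lt_trans _ _ (Num.bound (2 / eps))%:R); last by rewrite ltr_nat.
by apply: archi_boundP; rewrite divr_ge0 // ltW.
Qed.

(** * Recurrent nodes, steps and counts of a fixed sequence *)

Definition selected_from_infinitely_often (V : finType) (pub : pred V) (x1 : V)
    (s : nat -> V) (x : V) : Prop :=
  forall m : nat, exists2 t : nat, (m <= t)%N & walk_pos pub x1 s t = x.

Lemma selection_count_homo (V : finType) (pub : pred V) (x1 : V) (g : rel V)
    (s : nat -> V) :
  {homo selection_count pub x1 g s : m n / (m <= n)%N}.
Proof.
by apply: homo_leq => [//|n m p|n]; [exact: leq_trans|rewrite selection_countS leq_addr].
Qed.

Lemma selection_count_unbounded (V : finType) (pub : pred V) (x1 : V)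
    (s : nat -> V) (x : V) :
  selected_from_infinitely_often pub x1 s x ->
  forall M : nat, exists n, (M <= selection_count pub x1 (from_into x [set: V]%SET) s n)%N.
Proof.
move=> xio; elim=> [|M [n Mn]]; first by exists 0%N.
have [t nt tx] := xio n; exists t.+1.
rewrite selection_countS /from_into /= tx eqxx inE addn1 ltnS.
exact: leq_trans Mn (selection_count_homo _ _ _ _ nt).
Qed.

(** Pigeonhole: if each node of [C] were left for good after some time, the walk would have nowhere
    to be at the maximum of these times. *)
Lemma exists_infinitely_often (V : finType) (pub : pred V) (x1 : V)
    (s : nat -> V) (C : {set V}) :
  (forall t, walk_pos pub x1 s t \in C) ->
  exists2 x, x \in C & selected_from_infinitely_often pub x1 s x.
Proof.
move=> posC; apply: contrapT => nio.
have /choice[m mP] : forall x : V, exists m, x \in C ->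
    forall t, (m <= t)%N -> walk_pos pub x1 s t <> x.
  move=> x; have [xC|xC] := boolP (x \in C); last by exists 0%N.
  have : ~ selected_from_infinitely_often pub x1 s x by move=> xio; apply: nio; exists x.
  by move=> /existsNP[m /forall2NP mn]; exists m => _ t mt; case: (mn t).
apply: (mP _ (posC (\max_x m x)%N) (\max_x m x)%N) => //.
exact: (leq_bigmax (walk_pos pub x1 s (\max_x m x)%N)).
Qed.

Lemma step_ofS (V : finType) (pub : pred V) (s : nat -> V) (t : nat) :
  step_of pub s t.+1 = (step_of pub s t + pub (s t))%N.
Proof. by rewrite /step_of big_ord_recr. Qed.

Lemma step_of_homo (V : finType) (pub : pred V) (s : nat -> V) :
  {homo step_of pub s : m n / (m <= n)%N}.
Proof.
by apply: homo_leq => [//|n m p|n]; [exact: leq_trans|rewrite step_ofS leq_addr].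
Qed.

Lemma step_of_le (V : finType) (pub : pred V) (s : nat -> V) (t : nat) :
  (step_of pub s t <= t.+1)%N.
Proof.
elim: t => [|t IHt]; first by rewrite /step_of big_ord0.
by rewrite step_ofS -addn1 leq_add // leq_b1.
Qed.

Lemma card_fset_set_initial (Q : pred nat) (n : nat) :
  #|` fset_set [set t | (t < n)%N /\ Q t]|%fset = (\sum_(t < n) Q t)%N.
Proof.
elim: n => [|n IHn].
  by rewrite big_ord0 (_ : mkset _ = set0) ?fset_set0 //; apply/seteqP; split => // t [].
have fin : finite_set [set t | (t < n)%N /\ Q t].
  by apply: sub_finite_set (finite_II n) => t [].
rewrite big_ord_recr /= -IHn; have [Qn|nQn] := boolP (Q n).
  rewrite (_ : [set t | (t < n.+1)%N /\ _] = n |` [set t | (t < n)%N /\ Q t]).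
    rewrite fset_setU1 // cardfsU1 in_fset_set // addnC; congr (_ + _)%N.
    suff -> : n \notin [set t | (t < n)%N /\ Q t] by [].
    by apply/negP; rewrite inE /= ltnn => -[].
  apply/seteqP; split => [t [/=]|t [->|[tn Qt]]] //=; last by split=> //; exact: leqW.
  by rewrite ltnS leq_eqVlt => /predU1P[->|tn] Qt; [left|right].
rewrite addn0; congr (#|` fset_set _|)%fset; apply/seteqP; split => t [/= tn Qt].
  split=> //; rewrite ltn_neqAle -ltnS tn andbT.
  by apply: contraNneq nQn => <-.
by split=> //; exact: leqW.
Qed.

(** The hypothesis says that steps 1 to [r] consist of exactly the first [n] selections. The
    selection sets are then finite, so [fset_set] does not fall back on its default, and counting by
    steps becomes counting by selections. *)
Lemma selections_initial (V : finType) (pub : pred V) (x1 : V) (s : nat -> V)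
    (r n : nat) (v : V) :
  (forall t, (step_of pub s t <= r)%N = (t < n)%N) ->
  b_count pub x1 s r v = selection_count pub x1 (from_into v [set: V]%SET) s n /\
  a_count pub x1 s r v =
    selection_count pub x1 (from_into v [set u | pub u]%SET) s n.
Proof.
move=> rn; split.
  rewrite /b_count.
  rewrite (_ : selections _ _ _ _ _ = [set t | (t < n)%N /\ walk_pos pub x1 s t == v]).
    rewrite card_fset_set_initial; apply: eq_bigr => j _.
    by rewrite /from_into /= inE andbT.
  by apply/seteqP; split => t; rewrite /selections /= rn => -[? /eqP].
rewrite /a_count.
rewrite (_ : _ `&` _ =
    [set t | (t < n)%N /\ (walk_pos pub x1 s t == v) && pub (s t)]).
  rewrite (card_fset_set_initial (fun t => (walk_pos pub x1 s t == v) && pub (s t))).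
  by apply: eq_bigr => j _; rewrite /from_into /= inE.
apply/seteqP; split => t; rewrite /selections /= rn.
  by move=> [[-> ->] ->]; rewrite eqxx.
by move=> [-> /andP[/eqP -> ->]].
Qed.

(** * Public clusters *)

Lemma public_cluster_pub (V : finType) (e : rel V) (pub : pred V)
    (C : {set V}) (v : V) :
  public_cluster e pub C -> v \in C -> pub v.
Proof.
move=> [c pc ->]; rewrite inE => /connectP[p]; elim/last_ind: p => [_ -> //|p z _].
by rewrite rcons_path last_rcons => /andP[_ /and3P[_ pz _]] ->.
Qed.

Lemma public_cluster_closed (V : finType) (e : rel V) (pub : pred V)
    (C : {set V}) (u v : V) :
  public_cluster e pub C -> u \in C -> e u v -> pub v -> v \in C.
Proof.
move=> CC uC uv pv; have pu := public_cluster_pub CC uC.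
case: CC uC => c pc ->; rewrite !inE => /connect_trans; apply.
by apply: connect1; rewrite /public_subgraph /= uv pv pu.
Qed.

Lemma public_cluster_connect (V : finType) (e : rel V) (e_sym : symmetric e)
    (pub : pred V) (C : {set V}) (u v : V) :
  public_cluster e pub C -> u \in C -> v \in C ->
  connect (public_subgraph e pub) u v.
Proof.
move=> [c pc ->]; rewrite !inE => cu; apply: connect_trans.
suff /sym_connect_sym -> : symmetric (public_subgraph e pub) by [].
by move=> x y; rewrite /public_subgraph /= e_sym andbCA.
Qed.

(* From here on the selections [s] are deterministic; [legal] and [frequencies]
   hold almost surely for those of the walk. *)
Section Pathwise.
Context (R : realType) (V : finType) (e : rel V) (e_sym : symmetric e)
  (e_irr : irreflexive e) (pub : pred V) (C : {set V})
  (CC : public_cluster e pub C) (x1 : V) (x1C : x1 \in C) (s : nat -> V)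
  (legal : forall t, e (walk_pos pub x1 s t) (s t))
  (frequencies : forall (x : V) (A : {set V}) (eps : R), 0 < eps ->
    exists K : R, forall n, `|deviation R e pub x1 x A s n| <=
      eps * (selection_count pub x1 (from_into x [set: V]%SET) s n)%:R + K).

(** * Recurrence of every node of the cluster *)

Lemma walk_pos_in_cluster t : walk_pos pub x1 s t \in C.
Proof.
elim: t => [//|t IHt] /=; case: ifP => // ps.
exact: public_cluster_closed CC IHt (legal t) ps.
Qed.

(** If [y] were never visited from time [m] on, it would be selected from [x] at most [m] times,
    whereas the frequency bound forces about [q] times the unbounded number of selections at [x]. *)
Lemma infinitely_often_step x y :
  e x y -> pub y -> selected_from_infinitely_often pub x1 s x ->
  selected_from_infinitely_often pub x1 s y.
Proof.
move=> xy py xio; apply: contrapT => /existsNP[m /forall2NP my].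
have hits_le n : (selection_count pub x1 (from_into x [set y]%SET) s n <= m)%N.
  elim: n => [|n IHn]; first by rewrite /selection_count big_ord0.
  have [nm|mn] := ltnP n m.
    apply: leq_trans nm; elim: {IHn} n.+1 => [|i IHi].
      by rewrite /selection_count big_ord0.
    by rewrite selection_countS -addn1 leq_add // leq_b1.
  rewrite selection_countS /from_into /= inE.
  have [sy|_] := eqVneq (s n) y.
    (* Selecting the public node [y] at time [n] puts the walk there at time [n.+1]. *)
    by have := my n.+1; rewrite /= sy py; case => [[]|//]; exact: leqW.
  by rewrite andbF addn0.
have d_gt0 : (0 < degree e x)%N by apply/card_gt0P; exists y; rewrite inE.
pose q : R := transition_prob R e x [set y]%SET.
have qE : q = (degree e x)%:R^-1.
  by rewrite /q /transition_prob big_set1 /uniform_neighbor xy.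
have q_gt0 : 0 < q by rewrite qE invr_gt0 ltr0n.
have q2_gt0 : 0 < q / 2 by rewrite divr_gt0.
have [K HK] := frequencies x [set y]%SET q2_gt0.
(* With [eps = q / 2] the hits are at least [q / 2] times the selections at [x], minus [K]; beyond
   this threshold that exceeds [m]. *)
have [n Nn] := selection_count_unbounded xio (Num.bound (2 * (m%:R + `|K|) / q)).
have := HK n; rewrite /deviation -/q ler_norml => /andP[+ _].
apply/negP; rewrite -ltNge.
have : (selection_count pub x1 (from_into x [set y]%SET) s n)%:R <= m%:R :> R.
  by rewrite ler_nat.
have : 2 * (m%:R + `|K|) / q <
    (selection_count pub x1 (from_into x [set: V]%SET) s n)%:R.
  apply: lt_le_trans (_ : (Num.bound (2 * (m%:R + `|K|) / q))%:R <= _).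
    by apply: archi_boundP; rewrite divr_ge0 ?mulr_ge0 ?addr_ge0 // ltW.
  by rewrite ler_nat.
rewrite ltr_pdivrMr // => h1 h2; have := ler_norm K; lra.
Qed.

Lemma cluster_infinitely_often y :
  y \in C -> selected_from_infinitely_often pub x1 s y.
Proof.
move=> yC; have [x xC xio] := exists_infinitely_often walk_pos_in_cluster.
have /connectP[p xp ->] := public_cluster_connect e_sym CC xC yC.
elim: p x xio xp {xC} => [//|z p IHp] x xio /= /andP[/and3P[_ pz xz] zp].
exact: IHp (infinitely_often_step xz pz xio) zp.
Qed.

Context (C_edge : exists u v : V, cluster_edge e C u v).

(** Without public selections after time [m] the walk would stay put, yet it visits both ends of an
    edge of the cluster after [m]; they would coincide, against irreflexivity. *)
Lemma step_of_unbounded r : exists t, (r < step_of pub s t)%N.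
Proof.
elim: r => [|r [m rm]]; first by exists 0%N; rewrite /step_of big_ord0.
suff [t mt pt] : exists2 t, (m <= t)%N & pub (s t).
  exists t.+1; rewrite step_ofS pt addn1 ltnS.
  exact: leq_trans rm (step_of_homo _ _ mt).
apply: contrapT => npub.
have stuck t : (m <= t)%N -> walk_pos pub x1 s t = walk_pos pub x1 s m.
  elim: t => [|t IHt]; first by rewrite leqn0 => /eqP ->.
  rewrite leq_eqVlt => /predU1P[<- //|]; rewrite ltnS => mt /=.
  by case: ifP => [pt|_]; [case: npub; exists t|exact: IHt].
have [u [v /and3P[uC vC uv]]] := C_edge.
have [t mt tu] := cluster_infinitely_often uC m.
have [t' mt' tv] := cluster_infinitely_often vC m.
by move: uv; rewrite -tu -tv stuck // stuck // e_irr.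
Qed.

(** * Limit of the approximate public-degree *)

Lemma degree_gt0 v : v \in C -> (0 < degree e v)%N.
Proof.
move=> vC; have [t _ <-] := cluster_infinitely_often vC 0.
by apply/card_gt0P; exists (s t); rewrite inE.
Qed.

(** Public neighbors of a node of the cluster are themselves in the cluster, so counting them in the
    graph or in the cluster agrees. *)
Lemma public_degreeE v : v \in C ->
  (degree e v)%:R * transition_prob R e v [set u | pub u]%SET =
  (public_degree e C v)%:R.
Proof.
move=> vC; rewrite /transition_prob sum_uniform_neighbor mulrC divfK; last first.
  by rewrite pnatr_eq0 -lt0n degree_gt0.
congr (_ %:R); apply: eq_card => u; rewrite !inE /cluster_edge /= vC /=.
apply/andP/and3P => [[pu vu]|[uC _ vu]]; last first.
  by split => //; exact: public_cluster_pub CC uC.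
by have uC := public_cluster_closed CC vC vu pu; split.
Qed.

Lemma selection_ratio_cvg v : v \in C ->
  (fun n => (selection_count pub x1 (from_into v [set u | pub u]%SET) s n)%:R /
     (selection_count pub x1 (from_into v [set: V]%SET) s n)%:R) @ \oo -->
  transition_prob R e v [set u | pub u]%SET.
Proof.
move=> vC; apply/cvgrPdist_le => eps eps0.
have eps2_gt0 : 0 < eps / 2 by rewrite divr_gt0.
have [K HK] := frequencies v [set u | pub u]%SET eps2_gt0.
(* Past this threshold [K] is at most [eps / 2] times the count, which gives the second half of
   [eps]; the successor makes the denominator positive. *)
have [n0 Nn0] := selection_count_unbounded (cluster_infinitely_often vC)
  (Num.bound (2 * `|K| / eps)).+1.
exists n0 => // n /= n0n.
have := leq_trans Nn0 (selection_count_homo pub x1 (from_into v [set: V]%SET) s n0n).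
set N := selection_count _ _ _ _ n; set H := selection_count _ _ _ _ n => NK.
have N_gt0 : 0 < N%:R :> R by rewrite ltr0n; exact: leq_trans NK.
have KN : 2 * `|K| / eps < N%:R.
  apply: lt_trans (_ : (Num.bound (2 * `|K| / eps))%:R < _); last by rewrite ltr_nat.
  by apply: archi_boundP; rewrite divr_ge0 ?mulr_ge0 // ltW.
rewrite ltr_pdivrMr // in KN.
set q := transition_prob _ _ _ _.
rewrite distrC (_ : _ - q = (H%:R - q * N%:R) / N%:R) ?normrM; last first.
  by rewrite mulrBl mulfK // gt_eqF.
rewrite [X in _ * X]gtr0_norm ?invr_gt0 // ler_pdivrMr //.
apply: le_trans (HK n) _; rewrite -/N.
have := ler_norm K; lra.
Qed.

Lemma approx_public_degree_cvg v : v \in C ->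
  (fun r => approx_public_degree R e pub x1 s r v) @ \oo -->
  ((public_degree e C v)%:R : R).
Proof.
move=> vC; rewrite -public_degreeE //; apply: cvgMr.
(* [tau r] is the number of selections made in steps 1 to [r], that is, the index of the first
   selection of a later step. *)
have /choice[tau tauP] : forall r, exists n, forall t,
    (step_of pub s t <= r)%N = (t < n)%N.
  move=> r; have [n rn n_min] := ex_minnP (step_of_unbounded r); exists n => t.
  apply/idP/idP => [tr|tn]; rewrite ltnNge; apply/negP => h.
    by have := step_of_homo pub s h; rewrite leqNgt (leq_ltn_trans tr).
  by have := n_min t h; rewrite leqNgt tn.
under eq_fun do
  rewrite (selections_initial x1 v (tauP _)).1 (selections_initial x1 v (tauP _)).2.
have tau_oo : tau r @[r --> \oo] --> \oo.
  apply/cvgnyPge => A; exists A => // r /= Ar.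
  (* Every step contains a selection: selection [A], numbered from 0, belongs to a step at most
     [A.+1], so [tau r] is at least [r]. *)
  case: A Ar => // A Ar; rewrite -tauP; exact: leq_trans (step_of_le _ _ _) Ar.
exact: cvg_comp tau_oo (selection_ratio_cvg vC).
Qed.

End Pathwise.

Theorem lemma3p2 (R : realType) (V : finType) (e : rel V)
    (e_sym : symmetric e) (e_irr : irreflexive e) (e_conn : connected_graph e)
    (pub : pred V) (C : {set V}) (C_largest : largest_public_cluster e pub C)
    (C_edge : exists u v : V, cluster_edge e C u v)
    (x1 : V) (x1C : x1 \in C)
    (d : measure_display) (T : measurableType d) (P : probability T R)
    (S : nat -> T -> V) (S_walk : designed_random_walk e pub x1 P S)
    (k : nat) (k_ge1 : (1 <= k)%N) :
  {ae P, forall w : T,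
    (fun r : nat =>
       approx_public_degree R e pub x1 (S ^~ w) r (sample pub x1 (S ^~ w) k))
      @ \oo -->
    ((public_degree e C (sample pub x1 (S ^~ w) k))%:R : R)}.
Proof.
have [CC _] := C_largest.
apply: filterS2 (ae_legal_selections S_walk) (ae_frequencies S_walk) => w legal freq.
apply: approx_public_degree_cvg => //.
(* The pathwise limit holds for all nodes of the cluster on one event, so the random node may be
   substituted. A sample is a walk position whatever index [xget] returns, hence lies in the
   cluster. *)
by rewrite /sample; exact: (walk_pos_in_cluster CC x1C (s := S ^~ w) legal).
Qed.
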